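(* Let $0<h_a\le h_b$ be real numbers. For $\gamma\in(0,\pi)$ put $$a=\frac{h_b}{\sin\gamma},\quad b=\frac{h_a}{\sin\gamma},\quad c=\sqrt{a^2+b^2-2ab\cos\gamma},\quad l_a(\gamma)=\left\{bc\left[1-\frac{a^2}{(b+c)^2}\right]\right\}^{1/2}.$$ If $\tfrac12h_b<h_a<h_b$, then the function $\gamma\mapsto l_a(\gamma)$ has a local maximum in the interval $\left(0,\arccos\frac{h_b}{2h_a}\right)$; denote its value by $l_{\max}(h_a)$. Given $l_a>0$, the number of triangles with heights $h_a$, $h_b$ and bisector $l_a$ is as follows. (1) There are three such triangles if $\tfrac12h_b<h_a<h_b$ and $h_a<l_a<l_{\max}(h_a)$. (2) There are two such triangles if either $h_a=h_b$ and $h_b<l_a<\sqrt2\,h_b$, or $\tfrac12h_b<h_a<h_b$ and $l_a=l_{\max}(h_a)$. (3) There is only one such triangle if (i) $h_a=h_b$ and $l_a\ge\sqrt2\,h_b$; or (ii) $\tfrac12h_b<h_a<h_b$ and either $l_a>l_{\max}(h_a)$ or $l_a=h_a$; or (iii) $h_a\le\tfrac12h_b$ and $l_a>h_a$.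
   Context: For a non-degenerate triangle $ABC$ in the Euclidean plane with side lengths $a=BC$, $b=CA$, $c=AB$, $h_a$ and $h_b$ are the lengths of the heights (altitudes) from $A$ onto the line $BC$ and from $B$ onto the line $CA$, and $l_a$ is the length of the internal angle bisector from $A$, measured from $A$ to the side $BC$. The variable $\gamma$ is the angle $\angle C$, and $l_a(\gamma)$ is the length of the bisector from $A$ in the triangle with heights $h_a,h_b$ and $\angle C=\gamma$. Triangles are counted up to congruence. *)

(* Defs.v *)
From Stdlib Require Import Reals List.
From Coquelicot Require Import Coquelicot.
Open Scope R_scope.

Definition point : Type := (R * R)%type.

Definition distance (P Q : point) : R :=
  dist_euc (fst P) (snd P) (fst Q) (snd Q).

Definition vec (P Q : point) : point := (fst Q - fst P, snd Q - snd P).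

Definition dot (u v : point) : R := fst u * fst v + snd u * snd v.

Definition line_point (P Q : point) (t : R) : point :=
  (fst P + t * (fst Q - fst P), snd P + t * (snd Q - snd P)).

(* The measure, in [0, PI], of the unoriented angle POQ. *)
Definition angle (P O Q : point) : R :=
  acos (dot (vec O P) (vec O Q) / (distance O P * distance O Q)).

Definition collinear (A B C : point) : Prop :=
  (fst B - fst A) * (snd C - snd A) = (fst C - fst A) * (snd B - snd A).

Record triangle : Type := Triangle {
  vA : point;
  vB : point;
  vC : point;
  nondegenerate : ~ collinear vA vB vC
}.

(* Plane isometries, reflections included. *)
Definition isometry (f : point -> point) : Prop :=
  forall P Q : point, distance (f P) (f Q) = distance P Q.

(* Congruence respects the names of the vertices, as do the quantities h_a,
   h_b, l_a.  For triangles with the same h_a and h_b it makes no difference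
   if vertices may be permuted: a congruence of any kind preserves the area,
   hence a, b, and therefore also c. *)
Definition congruent (T T' : triangle) : Prop :=
  exists f : point -> point,
    isometry f /\ f (vA T) = vA T' /\ f (vB T) = vB T' /\ f (vC T) = vC T'.

(* h is the length of the height from P onto the line QS; the foot H of the
   height may lie outside the segment QS. *)
Definition height_length (P Q S : point) (h : R) : Prop :=
  exists t : R,
    let H := line_point Q S t in
    dot (vec H P) (vec Q S) = 0 /\ distance P H = h.

(* l is the length of the internal bisector of the angle at P of the triangle
   PQS, measured from P to the side QS. *)
Definition bisector_length (P Q S : point) (l : R) : Prop :=
  exists t : R,
    0 <= t <= 1 /\
    let D := line_point Q S t in
    angle Q P D = angle D P S /\ distance P D = l.

Definition has_data (ha hb la : R) (T : triangle) : Prop :=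
  height_length (vA T) (vB T) (vC T) ha /\
  height_length (vB T) (vC T) (vA T) hb /\
  bisector_length (vA T) (vB T) (vC T) la.

(* Up to congruence, exactly n triangles satisfy P. *)
Definition number_of_triangles (P : triangle -> Prop) (n : nat) : Prop :=
  exists Ts : list triangle,
    length Ts = n /\
    List.Forall P Ts /\
    List.ForallOrdPairs (fun T T' => ~ congruent T T') Ts /\
    (forall T : triangle, P T -> List.Exists (congruent T) Ts).

(* Meaningful only for 0 < gamma < PI. *)
Definition bisector_fun (ha hb gamma : R) : R :=
  let a := hb / sin gamma in
  let b := ha / sin gamma in
  let c := sqrt (a ^ 2 + b ^ 2 - 2 * a * b * cos gamma) in
  sqrt (b * c * (1 - a ^ 2 / (b + c) ^ 2)).

Definition local_maximum (f : R -> R) (x : R) : Prop :=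
  locally x (fun y => f y <= f x).

(* m is the value of a local maximum of l_a in (0, arccos (h_b / (2 h_a))).
   This interval is open and contained in (0, PI), so that neighbourhoods in R
   and in (0, PI) give the same local maxima. *)
Definition is_lmax (ha hb m : R) : Prop :=
  exists gamma : R,
    0 < gamma < acos (hb / (2 * ha)) /\
    local_maximum (bisector_fun ha hb) gamma /\
    bisector_fun ha hb gamma = m.

(* Main.v *)
(** Put [p = h_a], [q = h_b] and [w = c sin gamma].  Since [a sin gamma = q] and
    [b sin gamma = p], the sides are in the ratio [a : b : c = q : p : w], and
    [w] runs increasingly over [(q - p, q + p)] as [gamma] runs over [(0, PI)];
    so the triangles with heights [p], [q] are parametrized by [w], and
    [l_a^2 = 4 p^3 q^2 w / ((p + w)^2 (q^2 - (w - p)^2))].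
    The derivative of this function has the sign of
    [(w^2 - p^2) (3 w^2 - (q^2 - p^2))].  If [q / 2 < p < q], then
    [w = sqrt ((q^2 - p^2) / 3)] is the local maximum and [w = p], where
    [l_a = p], is the minimum; if [p = q] only the minimum remains, and if
    [p <= q / 2] there is no critical point in the interval.  The count
    of triangles is the count of solutions on the monotone pieces.  The
    monotonicity is obtained without derivatives, from the factored difference
    of two values. *)
Require Import Defs.
From Stdlib Require Import Reals List.
From Coquelicot Require Import Coquelicot.
From Stdlib Require Import Lra.
Open Scope R_scope.

(** * Distances, signed areas and Heron's formula in coordinates *)

Lemma sqr_lt_reg (x y : R) : 0 <= y -> x ^ 2 < y ^ 2 -> x < y.
Proof. nra. Qed.

Lemma sqr_eq_reg (x y : R) : 0 <= x -> 0 <= y -> x ^ 2 = y ^ 2 -> x = y.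
Proof. intros Hx Hy H; apply Rsqr_inj; unfold Rsqr; lra. Qed.

(** Twice the signed area of the triangle [PQS]. *)
Definition cross (P Q S : point) : R :=
  (fst Q - fst P) * (snd S - snd P) - (fst S - fst P) * (snd Q - snd P).

Lemma distance_nonneg (P Q : point) : 0 <= distance P Q.
Proof. apply sqrt_pos. Qed.

Lemma distance_sqr (P Q : point) :
  distance P Q ^ 2 = (fst Q - fst P) ^ 2 + (snd Q - snd P) ^ 2.
Proof.
unfold distance, dist_euc; rewrite pow2_sqrt; [unfold Rsqr; ring|].
apply Rplus_le_le_0_compat; apply Rle_0_sqr.
Qed.

Lemma distance_sym (P Q : point) : distance P Q = distance Q P.
Proof. apply distance_symm. Qed.

Lemma distance_eq (P Q : point) (d : R) :
  0 <= d -> (fst Q - fst P) ^ 2 + (snd Q - snd P) ^ 2 = d ^ 2 ->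
  distance P Q = d.
Proof.
intros Hd H; rewrite <- distance_sqr in H.
pose proof (distance_nonneg P Q); nra.
Qed.

Lemma cross_neq0 (P Q S : point) : ~ collinear P Q S <-> cross P Q S <> 0.
Proof. unfold collinear, cross; split; intros H E; apply H; lra. Qed.

Lemma cross_rot (P Q S : point) : cross Q S P = cross P Q S.
Proof. unfold cross; ring. Qed.

Lemma law_of_cosines (P Q S : point) :
  distance Q S ^ 2 =
  distance P Q ^ 2 + distance P S ^ 2 - 2 * dot (vec P Q) (vec P S).
Proof. rewrite !distance_sqr; unfold dot, vec; simpl; ring. Qed.

Lemma cross_sqr_dot (P Q S : point) :
  cross P Q S ^ 2 =
  distance P Q ^ 2 * distance P S ^ 2 - dot (vec P Q) (vec P S) ^ 2.
Proof. rewrite !distance_sqr; unfold cross, dot, vec; simpl; ring. Qed.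

(** Both sides are sixteen times the squared area, so the area depends on the side lengths only. *)
Lemma heron (P Q S : point) :
  4 * cross P Q S ^ 2 =
  4 * distance P Q ^ 2 * distance P S ^ 2
  - (distance P Q ^ 2 + distance P S ^ 2 - distance Q S ^ 2) ^ 2.
Proof. rewrite cross_sqr_dot, (law_of_cosines P Q S); ring. Qed.

Lemma distance_eq0 (P Q : point) :
  0 = distance P Q -> fst Q - fst P = 0 /\ snd Q - snd P = 0.
Proof.
intros E; apply Rplus_sqr_eq_0; pose proof (distance_sqr P Q) as D.
rewrite <- E in D; unfold Rsqr; lra.
Qed.

Lemma distance_pos (P Q S : point) : cross P Q S <> 0 -> 0 < distance P Q.
Proof.
intros H; destruct (distance_nonneg P Q) as [|E]; [easy|].
exfalso; apply H; destruct (distance_eq0 P Q E) as [X Y].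
unfold cross; rewrite X, Y; ring.
Qed.

(** * Angles, heights and bisectors as polynomial conditions on lengths *)

Lemma cos_range (u v k : R) :
  0 < u -> 0 < v -> k ^ 2 <= u ^ 2 * v ^ 2 -> -1 <= k / (u * v) <= 1.
Proof.
intros Hu Hv H; assert (Huv : 0 < u * v) by nra.
rewrite <- Rpow_mult_distr in H; set (w := u * v) in *.
split; [apply Rle_div_r | apply Rle_div_l]; nra.
Qed.

Lemma dot_abs (P Q S : point) :
  dot (vec P Q) (vec P S) ^ 2 <= distance P Q ^ 2 * distance P S ^ 2.
Proof. pose proof (cross_sqr_dot P Q S); nra. Qed.

(** By Cauchy-Schwarz both quotients lie in [-1, 1], where [acos] is injective; equal angles thus
    mean equal cosines, and denominators can be cleared. *)
Lemma angle_eq_iff (P Q S D : point) :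
  0 < distance P Q -> 0 < distance P S -> 0 < distance P D ->
  angle Q P D = angle D P S <->
  distance P S * dot (vec P Q) (vec P D) =
  distance P Q * dot (vec P D) (vec P S).
Proof.
intros Hm Hn Hd; unfold angle.
set (m := distance P Q) in *; set (n := distance P S) in *.
set (d := distance P D) in *.
set (x := dot (vec P Q) (vec P D)); set (y := dot (vec P D) (vec P S)).
split; intros H.
- assert (E : x / (m * d) = y / (d * n)).
  { rewrite <- (cos_acos (x / (m * d))), <- (cos_acos (y / (d * n))), H;
      [easy | |]; apply cos_range; try easy; apply dot_abs. }
  replace x with (x / (m * d) * (m * d)) by (field; lra).
  rewrite E; field; lra.
- f_equal; replace x with (m * y / n).
  + field; lra.
  + rewrite <- H; field; lra.
Qed.

(** Base times height is twice the area. Squaring removes the orientation of [cross], and [0 <= h]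
    restores what squaring loses. *)
Lemma height_length_iff (P Q S : point) (h : R) :
  cross P Q S <> 0 ->
  height_length P Q S h <->
  0 <= h /\ h ^ 2 * distance Q S ^ 2 = cross P Q S ^ 2.
Proof.
intros HX.
assert (Ha : 0 < distance Q S)
  by (apply (distance_pos Q S P); rewrite cross_rot; exact HX).
assert (L : forall t, dot (vec (line_point Q S t) P) (vec Q S) = 0 ->
  distance P (line_point Q S t) ^ 2 * distance Q S ^ 2 = cross P Q S ^ 2).
{ intros t H.
  (* Lagrange's identity for the vector from the foot to [P] and the vector [QS]; their cross
     product does not depend on where the point lies on the line [QS]. *)
  transitivity (cross P Q S ^ 2 + dot (vec (line_point Q S t) P) (vec Q S) ^ 2).
  - rewrite !distance_sqr; unfold cross, dot, vec, line_point; simpl; ring.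
  - rewrite H; ring. }
split.
- intros [t [H1 <-]]; split; [apply distance_nonneg | apply L, H1].
- intros [Hh H].
  set (t := dot (vec Q P) (vec Q S) / distance Q S ^ 2).
  assert (Ht : dot (vec (line_point Q S t) P) (vec Q S) = 0).
  { transitivity (dot (vec Q P) (vec Q S) - t * distance Q S ^ 2).
    - rewrite distance_sqr; unfold dot, vec, line_point; simpl; ring.
    - unfold t; field; lra. }
  exists t; split; [exact Ht|].
  apply distance_eq; [exact Hh|].
  rewrite <- distance_sqr.
  apply Rmult_eq_reg_r with (distance Q S ^ 2); [rewrite L, H; easy | nra].
Qed.

(** The angle condition forces the bisector to divide [QS] in the ratio [PQ : PS]. Expanding the
    length at that point of division gives the classical formula, here with its denominator
    cleared. *)
Lemma bisector_length_iff (P Q S : point) (l : R) :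
  cross P Q S <> 0 ->
  bisector_length P Q S l <->
  0 <= l /\
  l ^ 2 * (distance P Q + distance P S) ^ 2 =
  distance P Q * distance P S *
  ((distance P Q + distance P S) ^ 2 - distance Q S ^ 2).
Proof.
intros HX.
assert (Hm : 0 < distance P Q) by (apply (distance_pos P Q S); exact HX).
assert (Hn : 0 < distance P S).
{ rewrite distance_sym; apply (distance_pos S P Q).
  rewrite <- (cross_rot S P Q); exact HX. }
assert (Hd : forall t, 0 < distance P (line_point Q S t)).
{ intros t; destruct (distance_nonneg P (line_point Q S t)) as [|E]; [easy|].
  exfalso; apply HX; destruct (distance_eq0 _ _ E) as [X Y].
  transitivity ((fst (line_point Q S t) - fst P) * (snd S - snd Q)
    - (snd (line_point Q S t) - snd P) * (fst S - fst Q)).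
  - unfold cross, line_point; simpl; ring.
  - rewrite X, Y; ring. }
set (k := dot (vec P Q) (vec P S)).
assert (Hk : k ^ 2 < distance P Q ^ 2 * distance P S ^ 2).
{ pose proof (cross_sqr_dot P Q S) as D; fold k in D; nra. }
assert (E1 : forall t, dot (vec P Q) (vec P (line_point Q S t)) =
  (1 - t) * distance P Q ^ 2 + t * k).
{ intros t; rewrite distance_sqr; unfold k, dot, vec, line_point; simpl; ring. }
assert (E2 : forall t, dot (vec P (line_point Q S t)) (vec P S) =
  (1 - t) * k + t * distance P S ^ 2).
{ intros t; rewrite distance_sqr; unfold k, dot, vec, line_point; simpl; ring. }
assert (E3 : forall t, distance P (line_point Q S t) ^ 2 =
  (1 - t) ^ 2 * distance P Q ^ 2 + 2 * t * (1 - t) * k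
  + t ^ 2 * distance P S ^ 2).
{ intros t; rewrite !distance_sqr; unfold k, dot, vec, line_point; simpl; ring. }
assert (HA : forall t,
  angle Q P (line_point Q S t) = angle (line_point Q S t) P S <->
  t = distance P Q / (distance P Q + distance P S)).
{ intros t; rewrite angle_eq_iff, E1, E2 by auto.
  set (m := distance P Q) in *; set (n := distance P S) in *.
  assert (k < m * n).
  { apply sqr_lt_reg; [nra|]; rewrite Rpow_mult_distr; exact Hk. }
  split; intros H0.
  (* The first factor is positive by strict Cauchy-Schwarz, so the second must vanish. *)
  - assert (F : (m * n - k) * (m - t * (m + n)) = 0) by lra.
    apply Rmult_integral in F; destruct F as [F|F]; [lra|].
    apply (Rmult_eq_reg_r (m + n)); [|lra]; field_simplify; lra.
  - rewrite H0; field; lra. }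
assert (HL : forall t, t = distance P Q / (distance P Q + distance P S) ->
  distance P (line_point Q S t) ^ 2 * (distance P Q + distance P S) ^ 2 =
  distance P Q * distance P S *
  ((distance P Q + distance P S) ^ 2 - distance Q S ^ 2)).
{ intros t ->; rewrite E3, (law_of_cosines P Q S); fold k; field; lra. }
split.
- intros [t [_ [H1 <-]]]; apply HA in H1.
  split; [apply distance_nonneg | apply HL, H1].
- intros [Hl H].
  set (t := distance P Q / (distance P Q + distance P S)).
  exists t; split; [|split].
  + unfold t; split; [apply Rle_div_r | apply Rle_div_l]; lra.
  + apply HA; reflexivity.
  + apply distance_eq; [exact Hl|]; rewrite <- distance_sqr.
    specialize (HL t eq_refl); rewrite <- H in HL.
    apply Rmult_eq_reg_r in HL; nra.
Qed.

(** * Triangles described by their sides *)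

Definition side_a (T : Defs.triangle) : R := distance (vB T) (vC T).
Definition side_b (T : Defs.triangle) : R := distance (vC T) (vA T).
Definition side_c (T : Defs.triangle) : R := distance (vA T) (vB T).

Lemma cross_triangle (T : Defs.triangle) : cross (vA T) (vB T) (vC T) <> 0.
Proof. apply cross_neq0, nondegenerate. Qed.

Lemma sides_pos (T : Defs.triangle) : 0 < side_a T /\ 0 < side_b T /\ 0 < side_c T.
Proof.
pose proof (cross_triangle T) as H; unfold side_a, side_b, side_c.
repeat split; eapply distance_pos.
- rewrite cross_rot; exact H.
- rewrite cross_rot, cross_rot; exact H.
- exact H.
Qed.

Lemma heron_triangle (T : Defs.triangle) :
  4 * cross (vA T) (vB T) (vC T) ^ 2 =
  4 * side_a T ^ 2 * side_b T ^ 2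
  - (side_a T ^ 2 + side_b T ^ 2 - side_c T ^ 2) ^ 2.
Proof.
rewrite <- (cross_rot (vA T)), <- (cross_rot (vB T)), heron.
unfold side_a, side_b, side_c.
rewrite (distance_sym (vC T) (vB T)); ring.
Qed.

(** Both heights yield the same doubled area. Hence one height condition becomes [p a = q b], and
    the other is expressed through Heron's formula. *)
Lemma has_data_iff (p q l : R) (T : Defs.triangle) :
  0 < p -> 0 < q -> 0 < l ->
  has_data p q l T <->
  p * side_a T = q * side_b T /\
  4 * p ^ 2 * side_a T ^ 2 =
    4 * side_a T ^ 2 * side_b T ^ 2
    - (side_a T ^ 2 + side_b T ^ 2 - side_c T ^ 2) ^ 2 /\
  l ^ 2 * (side_b T + side_c T) ^ 2 =
    side_b T * side_c T * ((side_b T + side_c T) ^ 2 - side_a T ^ 2).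
Proof.
intros Hp Hq Hl; unfold has_data.
pose proof (cross_triangle T) as HX.
rewrite (height_length_iff (vA T)) by exact HX.
rewrite (height_length_iff (vB T)) by (rewrite cross_rot; exact HX).
rewrite bisector_length_iff by exact HX.
rewrite (cross_rot (vA T)), <- heron_triangle.
destruct (sides_pos T) as [Ha [Hb Hc]].
rewrite (distance_sym (vA T) (vC T)).
fold (side_a T) (side_b T) (side_c T).
rewrite (Rplus_comm (side_c T)), (Rmult_comm (side_c T)).
set (X := cross _ _ _) in *.
split.
- intros [[_ H1] [[_ H2] [_ H3]]]; repeat split; [|lra | exact H3].
  apply Rsqr_inj; unfold Rsqr; nra.
- intros [H1 [H2 H3]]; repeat split; try lra.
  replace (q ^ 2 * side_b T ^ 2) with ((q * side_b T) ^ 2) by ring.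
  rewrite <- H1; lra.
Qed.

(** The converse is the side-side-side criterion: an affine map is an isometry once it preserves the
    inner products of a frame, and the law of cosines computes these from the sides. *)
Lemma congruent_sides (T T' : Defs.triangle) :
  congruent T T' <->
  side_a T = side_a T' /\ side_b T = side_b T' /\ side_c T = side_c T'.
Proof.
unfold side_a, side_b, side_c; split.
- intros [f [Hf [<- [<- <-]]]]; rewrite !Hf; auto.
- intros [Ha [Hb Hc]]; unfold congruent.
  pose proof (cross_triangle T) as HX.
  set (A := vA T) in *; set (B := vB T) in *; set (C := vC T) in *.
  set (A' := vA T') in *; set (B' := vB T') in *; set (C' := vC T') in *.
  (* The affine map that sends the frame (A; B, C) to (A'; B', C'). *)
  set (al := fun X : point => cross A X C / cross A B C).
  set (be := fun X : point => cross A B X / cross A B C).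
  set (f := fun X : point =>
    ((fst A' + al X * (fst B' - fst A') + be X * (fst C' - fst A'),
      snd A' + al X * (snd B' - snd A') + be X * (snd C' - snd A')) : point)).
  assert (HA : al A = 0 /\ be A = 0)
    by (unfold al, be; split; unfold cross at 1; field; exact HX).
  assert (HB : al B = 1 /\ be B = 0)
    by (unfold al, be; split; unfold cross at 1;
        [unfold cross in *; field; exact HX | field; exact HX]).
  assert (HC : al C = 0 /\ be C = 1)
    by (unfold al, be; split; unfold cross at 1;
        [field; exact HX | unfold cross in *; field; exact HX]).
  exists f; split; [|repeat split].
  + intros P Q.
    apply distance_eq; [apply distance_nonneg|].
    pose proof (law_of_cosines A B C) as L.
    pose proof (law_of_cosines A' B' C') as L'.
    rewrite Ha, Hc, (distance_sym A C), Hb in L.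
    rewrite (distance_sym A' C') in L'.
    set (x := al Q - al P); set (y := be Q - be P).
    (* The squared distance is a quadratic form in the affine coordinates [x], [y], with the inner
       products of the frame as coefficients. *)
    transitivity (x ^ 2 * distance A' B' ^ 2
      + 2 * x * y * dot (vec A' B') (vec A' C') + y ^ 2 * distance C' A' ^ 2).
    { rewrite !distance_sqr; unfold x, y, f, dot, vec; simpl; ring. }
    replace (dot (vec A' B') (vec A' C')) with (dot (vec A B) (vec A C)) by lra.
    assert (Ex : fst Q - fst P =
      x * (fst B - fst A) + y * (fst C - fst A))
      by (unfold x, y, al, be, cross in *; field; exact HX).
    assert (Ey : snd Q - snd P =
      x * (snd B - snd A) + y * (snd C - snd A))
      by (unfold x, y, al, be, cross in *; field; exact HX).
    rewrite <- Hb, <- Hc, !distance_sqr, Ex, Ey.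
    unfold dot, vec; simpl; ring.
  + unfold f; destruct HA as [-> ->]; rewrite (surjective_pairing A'); simpl.
    f_equal; ring.
  + unfold f; destruct HB as [-> ->]; rewrite (surjective_pairing B'); simpl.
    f_equal; ring.
  + unfold f; destruct HC as [-> ->]; rewrite (surjective_pairing C'); simpl.
    f_equal; ring.
Qed.

(** * Separation of the shape [w] from the scale [t] *)

Definition quartic (p q w : R) : R := (p + w) ^ 2 * (q ^ 2 - (w - p) ^ 2).

Definition bisector_sqr (p q w : R) : R := 4 * p ^ 3 * q ^ 2 * w / quartic p q w.

(** The ratio [q : p] makes [p a = q b] automatic. The height then fixes the scale [t], and
    eliminating [t] from the bisector formula leaves an equation in [w] alone. *)
Lemma has_data_scaled (p q l w t : R) (T : Defs.triangle) :
  0 < p -> 0 < q -> 0 < l -> 0 < w -> 0 < t ->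
  side_a T = q * t -> side_b T = p * t -> side_c T = w * t ->
  has_data p q l T <->
  t ^ 2 * (((p + w) ^ 2 - q ^ 2) * (q ^ 2 - (w - p) ^ 2)) = 4 * p ^ 2 * q ^ 2 /\
  l ^ 2 * quartic p q w = 4 * p ^ 3 * q ^ 2 * w.
Proof.
intros Hp Hq Hl Hw Ht Ea Eb Ec.
rewrite has_data_iff, Ea, Eb, Ec by easy; unfold quartic.
set (D1 := (p + w) ^ 2 - q ^ 2); set (D2 := q ^ 2 - (w - p) ^ 2).
assert (t ^ 2 <> 0) by (apply pow_nonzero; lra).
(* Heron's expression for the sides [q], [p], [w] factors as [D1 * D2]. *)
assert (E1 : 4 * p ^ 2 * (q * t) ^ 2 =
    4 * (q * t) ^ 2 * (p * t) ^ 2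
      - ((q * t) ^ 2 + (p * t) ^ 2 - (w * t) ^ 2) ^ 2 <->
    t ^ 2 * (D1 * D2) = 4 * p ^ 2 * q ^ 2).
{ replace (4 * (q * t) ^ 2 * (p * t) ^ 2 - _)
    with (t ^ 2 * (t ^ 2 * (D1 * D2))) by (unfold D1, D2; ring).
  replace (4 * p ^ 2 * (q * t) ^ 2) with (t ^ 2 * (4 * p ^ 2 * q ^ 2)) by ring.
  split; intros E; [|now rewrite E].
  apply Rmult_eq_reg_l in E; auto. }
rewrite E1; clear E1.
assert (E2 : t ^ 2 * (D1 * D2) = 4 * p ^ 2 * q ^ 2 ->
  l ^ 2 * (p * t + w * t) ^ 2 =
    p * t * (w * t) * ((p * t + w * t) ^ 2 - (q * t) ^ 2) <->
  l ^ 2 * ((p + w) ^ 2 * D2) = 4 * p ^ 3 * q ^ 2 * w).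
{ intros E.
  assert (0 < 4 * p ^ 2 * q ^ 2) by (repeat apply Rmult_lt_0_compat; lra).
  assert (HD : D2 <> 0) by (intros Z; rewrite Z in E; lra).
  replace (4 * p ^ 3 * q ^ 2 * w) with (p * w * (4 * p ^ 2 * q ^ 2)) by ring.
  rewrite <- E.
  replace (l ^ 2 * (p * t + w * t) ^ 2) with (t ^ 2 * (l ^ 2 * (p + w) ^ 2))
    by ring.
  replace (p * t * (w * t) * ((p * t + w * t) ^ 2 - (q * t) ^ 2))
    with (t ^ 2 * (t ^ 2 * p * w * D1)) by (unfold D1; ring).
  split; intros F.
  - apply Rmult_eq_reg_l in F; [|easy].
    replace (l ^ 2 * ((p + w) ^ 2 * D2)) with (l ^ 2 * (p + w) ^ 2 * D2) by ring.
    rewrite F; ring.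
  - f_equal; apply Rmult_eq_reg_r with D2; [|easy].
    transitivity (l ^ 2 * ((p + w) ^ 2 * D2)); [ring|]; rewrite F; ring. }
split; [intros [_ H0] | intros H0; split; [ring|]]; tauto.
Qed.

(** * Congruence classes of triangles correspond to roots [w] *)

Section Heights.

Variables p q : R.
Hypothesis p_pos : 0 < p.
Hypothesis p_le_q : p <= q.

(** For [0 < p <= q] these are the strict triangle inequalities for sides [q], [p], [w]. *)
Definition admissible (w : R) : Prop := q - p < w < q + p.

Lemma admissible_factors (w : R) :
  admissible w ->
  0 < w /\ 0 < (p + w) ^ 2 - q ^ 2 /\ 0 < q ^ 2 - (w - p) ^ 2.
Proof.
unfold admissible; intros Hw; repeat split; [lra | |].
- replace (_ - _) with ((p + w - q) * (p + w + q)) by ring.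
  apply Rmult_lt_0_compat; lra.
- replace (_ - _) with ((q + p - w) * (q + w - p)) by ring.
  apply Rmult_lt_0_compat; lra.
Qed.

Lemma quartic_pos (w : R) : admissible w -> 0 < quartic p q w.
Proof.
intros Hw; destruct (admissible_factors w Hw) as [H0 [_ H2]].
apply Rmult_lt_0_compat; [apply pow_lt; lra | exact H2].
Qed.

Lemma bisector_sqr_eq_iff (w K : R) :
  admissible w ->
  bisector_sqr p q w = K <-> K * quartic p q w = 4 * p ^ 3 * q ^ 2 * w.
Proof.
intros Hw; pose proof (quartic_pos w Hw) as HG; unfold bisector_sqr.
split; [intros <- | intros <-]; field; lra.
Qed.

(** The vertex [C] is the origin, [B] lies on the first axis and [A] has ordinate [p]. In the proof
    [x] is [cos gamma], by the law of cosines, and [t] is [1 / sin gamma]. *)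
Lemma triangle_exists (w : R) :
  admissible w ->
  exists (t : R) (T : Defs.triangle), 0 < t /\
    t ^ 2 * (((p + w) ^ 2 - q ^ 2) * (q ^ 2 - (w - p) ^ 2)) = 4 * p ^ 2 * q ^ 2 /\
    side_a T = q * t /\ side_b T = p * t /\ side_c T = w * t.
Proof.
intros Hw; destruct (admissible_factors w Hw) as [H0 [H1 H2]].
set (D := ((p + w) ^ 2 - q ^ 2) * (q ^ 2 - (w - p) ^ 2)).
assert (HD : 0 < D) by (apply Rmult_lt_0_compat; easy).
assert (Hs : 0 < sqrt D) by (apply sqrt_lt_R0; easy).
set (t := 2 * p * q / sqrt D).
assert (Ht : 0 < t) by (apply Rdiv_lt_0_compat; nra).
assert (Et : t ^ 2 * D = 4 * p ^ 2 * q ^ 2).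
{ transitivity (t ^ 2 * sqrt D ^ 2); [now rewrite pow2_sqrt by lra|].
  unfold t; field; lra. }
set (x := (p ^ 2 + q ^ 2 - w ^ 2) / (2 * p * q)).
assert (Ex : t ^ 2 * (1 - x ^ 2) = 1).
{ transitivity (t ^ 2 * D / (4 * p ^ 2 * q ^ 2)).
  - unfold x, D; field; lra.
  - rewrite Et; field; lra. }
assert (Ex2 : 2 * p * q * x = p ^ 2 + q ^ 2 - w ^ 2) by (unfold x; field; lra).
clearbody t x.
assert (N : ~ collinear (p * t * x, p) (q * t, 0) (0, 0)).
{ apply cross_neq0; unfold cross; simpl.
  assert (0 < p * (q * t)) by (repeat apply Rmult_lt_0_compat; lra).
  intros Z; lra. }
exists t, (Triangle _ _ _ N); split; [easy|]; split; [exact Et|].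
unfold side_a, side_b, side_c; simpl; repeat split; apply distance_eq; cbn [fst snd];
  try (apply Rmult_le_pos; lra).
- ring.
- transitivity (p ^ 2 * (t ^ 2 * x ^ 2 + 1)); [ring|].
  replace (t ^ 2 * x ^ 2 + 1) with (t ^ 2) by lra; ring.
- transitivity (q ^ 2 * t ^ 2 - t ^ 2 * (2 * p * q * x)
    + p ^ 2 * (t ^ 2 * x ^ 2 + 1)); [ring|].
  replace (t ^ 2 * x ^ 2 + 1) with (t ^ 2) by lra; rewrite Ex2; ring.
Qed.

(* For a triangle with heights [p], [q] this is [c * sin gamma], so that
   [a : b : c = q : p : width]. *)
Definition width (T : Defs.triangle) : R := p * side_c T / side_b T.

Lemma has_data_width (l : R) (T : Defs.triangle) :
  0 < l -> has_data p q l T ->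
  admissible (width T) /\ bisector_sqr p q (width T) = l ^ 2 /\
  exists t : R, 0 < t /\
    t ^ 2 * (((p + width T) ^ 2 - q ^ 2) * (q ^ 2 - (width T - p) ^ 2)) =
      4 * p ^ 2 * q ^ 2 /\
    side_a T = q * t /\ side_b T = p * t /\ side_c T = width T * t.
Proof.
intros Hl H; destruct (sides_pos T) as [Ha [Hb Hc]].
assert (Hw : 0 < width T) by (apply Rdiv_lt_0_compat; nra).
assert (Ht : 0 < side_b T / p) by (apply Rdiv_lt_0_compat; lra).
pose proof H as Eab; apply has_data_iff in Eab; [|lra..]; destruct Eab as [Eab _].
assert (Ea : side_a T = q * (side_b T / p)).
{ apply Rmult_eq_reg_l with p; [rewrite Eab; field|]; lra. }
assert (Eb : side_b T = p * (side_b T / p)) by (field; lra).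
assert (Ec : side_c T = width T * (side_b T / p))
  by (unfold width; field; lra).
apply (has_data_scaled p q l (width T) (side_b T / p)) in H; try lra.
destruct H as [H1 H2].
assert (A : admissible (width T)).
{ set (w := width T) in *; set (t := side_b T / p) in *.
  assert (P1 : 0 < ((p + w) ^ 2 - q ^ 2) * (q ^ 2 - (w - p) ^ 2)).
  { apply Rmult_lt_reg_l with (t ^ 2); [apply pow_lt, Ht|].
    rewrite H1, Rmult_0_r; repeat apply Rmult_lt_0_compat; lra. }
  assert (P2 : 0 < (p + w - q) * (q + p - w)).
  { apply Rmult_lt_reg_l with ((p + w + q) * (q + w - p)).
    - apply Rmult_lt_0_compat; lra.
    - rewrite Rmult_0_r; eapply Rlt_le_trans; [exact P1|]; right; ring. }
  (* The factors [p + w - q] and [q + p - w] have a positive product and the positive sum [2 * p],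
     so both are positive. *)
  unfold admissible; nra. }
split; [exact A|]; split.
- apply bisector_sqr_eq_iff; easy.
- exists (side_b T / p); auto.
Qed.

Lemma width_congruent (T T' : Defs.triangle) :
  congruent T T' -> width T = width T'.
Proof.
rewrite congruent_sides; intros [_ [Eb Ec]]; unfold width; now rewrite Eb, Ec.
Qed.

(** Equal widths mean equal shapes, and the height equation then determines the scale. *)
Lemma congruent_width (l : R) (T T' : Defs.triangle) :
  0 < l -> has_data p q l T -> has_data p q l T' -> width T = width T' ->
  congruent T T'.
Proof.
intros Hl H H' E.
destruct (has_data_width l T Hl H) as [A [_ [t [Ht [Et [Ea [Eb Ec]]]]]]].
destruct (has_data_width l T' Hl H') as [_ [_ [t' [Ht' [Et' [Ea' [Eb' Ec']]]]]]].
rewrite <- E in *; rewrite <- Et' in Et.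
destruct (admissible_factors _ A) as [_ [H1 H2]].
apply Rmult_eq_reg_r in Et;
  [|apply Rgt_not_eq, Rmult_lt_0_compat; easy].
apply sqr_eq_reg in Et; [|lra..]; subst t'.
apply congruent_sides; repeat split; congruence.
Qed.

Lemma has_data_exists (l w : R) :
  0 < l -> admissible w -> bisector_sqr p q w = l ^ 2 ->
  exists T : Defs.triangle, has_data p q l T /\ width T = w.
Proof.
intros Hl Hw E; destruct (triangle_exists w Hw) as [t [T [Ht [Et [Ea [Eb Ec]]]]]].
exists T; split.
- apply (has_data_scaled p q l w t); try easy; [lra | | split; [easy|]].
  + apply (admissible_factors w Hw).
  + apply bisector_sqr_eq_iff; easy.
- unfold width; rewrite Eb, Ec; field; lra.
Qed.

(** The passage from geometry to algebra: [width] is a bijection from congruence classes of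
    solutions to admissible roots, so a complete list of roots without repetition counts the
    triangles. *)
Lemma number_of_triangles_roots (l : R) (ws : list R) :
  0 < l -> NoDup ws ->
  (forall w : R, In w ws <-> admissible w /\ bisector_sqr p q w = l ^ 2) ->
  number_of_triangles (has_data p q l) (length ws).
Proof.
intros Hl ND Hws.
assert (HT : exists Ts,
  Forall2 (fun w T => has_data p q l T /\ width T = w) ws Ts).
{ assert (F : List.Forall (fun w => admissible w /\ bisector_sqr p q w = l ^ 2) ws)
    by (apply Forall_forall; intros w; apply Hws).
  clear ND Hws; induction F as [|w ws [Hw E] _ [Ts IH]].
  - exists nil; constructor.
  - destruct (has_data_exists l w Hl Hw E) as [T HT].
    exists (T :: Ts); constructor; easy. }
destruct HT as [Ts HT]; exists Ts; repeat split.
- symmetry; eapply Forall2_length; exact HT.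
- clear ND Hws; induction HT; constructor; tauto.
- clear Hws; induction HT as [|w T ws Ts [_ Ew] HT IH]; [constructor|].
  apply NoDup_cons_iff in ND; destruct ND as [Hnin ND].
  constructor; [|auto].
  apply Forall_forall; intros T' HT' C; apply Hnin.
  clear - HT HT' C Ew.
  rewrite <- Ew, (width_congruent _ _ C).
  induction HT as [|w' T'' ws Ts [_ Ew'] _ IH]; [easy|].
  destruct HT' as [->|HT']; [left; easy | right; auto].
- intros T HTd; destruct (has_data_width l T Hl HTd) as [A [E _]].
  assert (I : In (width T) ws) by (apply Hws; easy).
  clear Hws ND; induction HT as [|w T' ws Ts [HT' Ew] _ IH]; [easy|].
  destruct I as [I|I].
  + constructor; apply (congruent_width l); auto; congruence.
  + apply Exists_cons_tl; auto.
Qed.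

(** * Monotonicity of the squared bisector length in [w] *)

Lemma bisector_sqr_sub (x y : R) :
  admissible x -> admissible y ->
  bisector_sqr p q y - bisector_sqr p q x =
  4 * p ^ 3 * q ^ 2 * (y - x) / (quartic p q x * quartic p q y) *
  ((x * y - p ^ 2) * (3 * (x * y) - (q ^ 2 - p ^ 2)) + x * y * (x - y) ^ 2).
Proof.
intros Hx Hy; destruct (admissible_factors x Hx) as [Px [_ Dx]].
destruct (admissible_factors y Hy) as [Py [_ Dy]].
unfold bisector_sqr, quartic; field; repeat split; lra.
Qed.

(** This leaves the sign of the difference to the last factor in [bisector_sqr_sub], which at
    [y = x] becomes [(x^2 - p^2) (3 x^2 - (q^2 - p^2))], the sign of the derivative. *)
Lemma bisector_sqr_sub_coef (x y : R) :
  admissible x -> admissible y -> x < y ->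
  0 < 4 * p ^ 3 * q ^ 2 * (y - x) / (quartic p q x * quartic p q y).
Proof.
intros Hx Hy H; apply Rdiv_lt_0_compat.
- repeat apply Rmult_lt_0_compat; lra.
- apply Rmult_lt_0_compat; apply quartic_pos; easy.
Qed.

(** Since [x y < y^2], both [x y - p^2] and [3 x y - (q^2 - p^2)] are negative, and their product is
    positive. *)
Lemma bisector_sqr_lt_left (x y : R) :
  admissible x -> admissible y -> x < y ->
  y <= p -> 3 * y ^ 2 <= q ^ 2 - p ^ 2 ->
  bisector_sqr p q x < bisector_sqr p q y.
Proof.
intros Hx Hy H H1 H2; pose proof (bisector_sqr_sub x y Hx Hy) as E.
pose proof (bisector_sqr_sub_coef x y Hx Hy H) as C.
apply Rminus_lt_0; rewrite E; apply Rmult_lt_0_compat; [exact C|].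
unfold admissible in *.
assert (0 < x * y) by nra; assert (x * y < y ^ 2) by nra.
assert (x * y < p ^ 2) by nra.
assert (0 < (p ^ 2 - x * y) * (q ^ 2 - p ^ 2 - 3 * (x * y)))
  by (apply Rmult_lt_0_compat; lra).
assert (0 <= x * y * (x - y) ^ 2)
  by (apply Rmult_le_pos; [lra | apply pow2_ge_0]).
lra.
Qed.

(** Since [x y > x^2], both of these factors are now positive. *)
Lemma bisector_sqr_lt_right (x y : R) :
  admissible x -> admissible y -> x < y ->
  p <= x -> q ^ 2 - p ^ 2 <= 3 * x ^ 2 ->
  bisector_sqr p q x < bisector_sqr p q y.
Proof.
intros Hx Hy H H1 H2; pose proof (bisector_sqr_sub x y Hx Hy) as E.
pose proof (bisector_sqr_sub_coef x y Hx Hy H) as C.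
apply Rminus_lt_0; rewrite E; apply Rmult_lt_0_compat; [exact C|].
unfold admissible in *.
assert (x ^ 2 < x * y) by nra; assert (p ^ 2 < x * y) by nra.
assert (0 < (x * y - p ^ 2) * (3 * (x * y) - (q ^ 2 - p ^ 2)))
  by (apply Rmult_lt_0_compat; lra).
assert (0 <= x * y * (x - y) ^ 2)
  by (apply Rmult_le_pos; [nra | apply pow2_ge_0]).
lra.
Qed.

(** Here the product is negative and has to outweigh the positive term [x y (x - y)^2]; its absolute
    value is at least three times that term. *)
Lemma bisector_sqr_gt_middle (x y : R) :
  admissible x -> admissible y -> x < y ->
  y <= p -> q ^ 2 - p ^ 2 <= 3 * x ^ 2 ->
  bisector_sqr p q y < bisector_sqr p q x.
Proof.
intros Hx Hy H H1 H2; pose proof (bisector_sqr_sub x y Hx Hy) as E.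
pose proof (bisector_sqr_sub_coef x y Hx Hy H) as C.
apply Rminus_lt; rewrite E; apply Rmult_pos_neg; [exact C|].
unfold admissible in *.
(* [p ^ 2 - x y >= y (y - x)] and [x y - (q ^ 2 - p ^ 2) / 3 >= x (y - x)]. *)
assert (0 < x) by lra.
assert (L1 : y * (y - x) <= p ^ 2 - x * y) by nra.
assert (L2 : 3 * (x * (y - x)) <= 3 * (x * y) - (q ^ 2 - p ^ 2)) by nra.
assert (L3 : y * (y - x) * (3 * (x * (y - x))) <=
  (p ^ 2 - x * y) * (3 * (x * y) - (q ^ 2 - p ^ 2))).
{ apply Rmult_le_compat; try easy; nra. }
assert (0 < x * y * (x - y) ^ 2).
{ replace ((x - y) ^ 2) with ((y - x) ^ 2) by ring.
  apply Rmult_lt_0_compat; [nra | apply pow_lt; lra]. }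
lra.
Qed.

(** For admissible [w] the coefficient of [(w - p)^2] is positive. Geometrically, the bisector from
    [A] is at least as long as the height from [A], with equality exactly when [b = c]. *)
Lemma bisector_sqr_sub_height (w : R) :
  admissible w ->
  bisector_sqr p q w - p ^ 2 =
  p ^ 2 * ((p + w) ^ 2 - q ^ 2) / quartic p q w * (w - p) ^ 2.
Proof.
intros Hw; destruct (admissible_factors w Hw) as [P [_ D]].
unfold bisector_sqr, quartic; field; repeat split; lra.
Qed.

Lemma bisector_sqr_gt_height (w : R) :
  admissible w -> w <> p -> p ^ 2 < bisector_sqr p q w.
Proof.
intros Hw N; apply Rminus_lt_0; rewrite bisector_sqr_sub_height by easy.
destruct (admissible_factors w Hw) as [_ [H1 _]].
apply Rmult_lt_0_compat; [|apply pow2_gt_0; lra].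
apply Rdiv_lt_0_compat; [|apply quartic_pos; easy].
apply Rmult_lt_0_compat; [apply pow_lt|]; easy.
Qed.

Lemma bisector_sqr_height : admissible p -> bisector_sqr p q p = p ^ 2.
Proof.
intros Hw; apply Rminus_diag_uniq; rewrite bisector_sqr_sub_height by easy; ring.
Qed.

(** * Existence of roots by the intermediate value theorem *)

Definition root_poly (K w : R) : R := K * quartic p q w - 4 * p ^ 3 * q ^ 2 * w.

Lemma root_poly_eq (K w : R) :
  admissible w -> root_poly K w = quartic p q w * (K - bisector_sqr p q w).
Proof.
intros Hw; pose proof (quartic_pos w Hw); unfold root_poly, bisector_sqr.
field; lra.
Qed.

(** The polynomial form is used because it is continuous up to the ends of the admissible interval,
    where the denominator [quartic] may vanish. *)
Lemma bisector_sqr_root (K x y : R) :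
  q - p <= x -> x < y -> y <= q + p -> root_poly K x * root_poly K y < 0 ->
  exists w : R, x < w < y /\ admissible w /\ bisector_sqr p q w = K.
Proof.
intros Hx Hxy Hy S.
assert (Hc : continuity (root_poly K)) by (unfold root_poly, quartic; reg).
destruct (IVT_cor _ x y Hc) as [w [Hw E]]; [lra | lra |].
assert (w <> x) by (intros ->; rewrite E in S; lra).
assert (w <> y) by (intros ->; rewrite E in S; lra).
assert (A : admissible w) by (unfold admissible; lra).
exists w; split; [lra|]; split; [exact A|].
apply bisector_sqr_eq_iff; [exact A|]; unfold root_poly in E; lra.
Qed.

(** At this end [quartic] vanishes: the bisector length is unbounded there. *)
Lemma root_poly_right (K : R) : root_poly K (q + p) < 0.
Proof.
unfold root_poly, quartic.
replace (_ - _) with (- (4 * p ^ 3 * q ^ 2 * (q + p))) by ring.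
apply Ropp_lt_gt_0_contravar; repeat apply Rmult_lt_0_compat; lra.
Qed.

(** For [p < q] the squared bisector length tends to [p^2] at [w = q - p], hence lies below [K] near
    this end. *)
Lemma root_poly_left (K : R) :
  p < q -> p ^ 2 < K -> 0 < root_poly K (q - p).
Proof.
intros H HK; unfold root_poly, quartic.
replace (_ - _) with (4 * p * q ^ 2 * (q - p) * (K - p ^ 2)) by ring.
repeat apply Rmult_lt_0_compat; lra.
Qed.

Lemma bisector_sqr_root_right (K : R) :
  q < 2 * p -> p ^ 2 < K ->
  exists w : R, p < w /\ admissible w /\ bisector_sqr p q w = K.
Proof.
intros H HK; assert (A : admissible p) by (unfold admissible; lra).
destruct (bisector_sqr_root K p (q + p)) as [w [Hw Ew]]; [lra..| |].
- rewrite root_poly_eq, bisector_sqr_height by easy.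
  apply Rmult_pos_neg; [|apply root_poly_right].
  apply Rmult_lt_0_compat; [apply quartic_pos; easy | lra].
- exists w; split; [lra | easy].
Qed.

(** From [q < 2 * p] follows [q^2 - p^2 < 3 p^2], so the increasing regime covers everything from
    [p] on. *)
Lemma bisector_sqr_inj_right (x y : R) :
  q < 2 * p -> admissible x -> admissible y -> p <= x -> p <= y ->
  bisector_sqr p q x = bisector_sqr p q y -> x = y.
Proof.
intros H Hx Hy Px Py E.
destruct (Rtotal_order x y) as [L|[L|L]]; [|easy|];
  apply bisector_sqr_lt_right in L; try easy; try nra.
Qed.

End Heights.

(** * Change of parameter between [gamma] and [w] *)

Section Angle.

Variables p q : R.
Hypothesis p_pos : 0 < p.
Hypothesis p_le_q : p <= q.

(** This is [c * sin gamma], from the law of cosines multiplied by [sin gamma ^ 2]. *)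
Definition width_of_angle (g : R) : R :=
  sqrt (p ^ 2 + q ^ 2 - 2 * p * q * cos g).

Definition angle_of_width (w : R) : R :=
  acos ((p ^ 2 + q ^ 2 - w ^ 2) / (2 * p * q)).

Lemma width_of_angle_sqr (g : R) :
  width_of_angle g ^ 2 = p ^ 2 + q ^ 2 - 2 * p * q * cos g.
Proof.
apply pow2_sqrt; pose proof (COS_bound g).
assert (0 <= p * q * (1 - cos g)) by (repeat apply Rmult_le_pos; lra).
pose proof (pow2_ge_0 (q - p)); lra.
Qed.

Lemma width_of_angle_nonneg (g : R) : 0 <= width_of_angle g.
Proof. apply sqrt_pos. Qed.

Lemma width_of_angle_lt_iff (g g' : R) :
  0 <= g <= PI -> 0 <= g' <= PI ->
  width_of_angle g < width_of_angle g' <-> g < g'.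
Proof.
intros Hg Hg'; pose proof (width_of_angle_sqr g) as E.
pose proof (width_of_angle_sqr g') as E'.
pose proof (width_of_angle_nonneg g); pose proof (width_of_angle_nonneg g').
assert (Hpq : 0 < 2 * p * q) by nra.
split; intros H1.
- apply cos_decreasing_0; try lra.
  apply Rmult_lt_reg_l with (2 * p * q); [easy|].
  assert (width_of_angle g ^ 2 < width_of_angle g' ^ 2) by nra; lra.
- assert (cos g' < cos g) by (apply cos_decreasing_1; lra).
  apply sqr_lt_reg; [easy|]; rewrite E, E'.
  assert (2 * p * q * cos g' < 2 * p * q * cos g)
    by (apply Rmult_lt_compat_l; easy).
  lra.
Qed.

Lemma width_of_angle_le (g g' : R) :
  0 <= g <= PI -> 0 <= g' <= PI -> g <= g' ->
  width_of_angle g <= width_of_angle g'.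
Proof.
intros Hg Hg' [H|<-]; [|apply Rle_refl].
apply Rlt_le, width_of_angle_lt_iff; easy.
Qed.

Lemma width_of_angle_admissible (g : R) :
  0 < g < PI -> admissible p q (width_of_angle g).
Proof.
intros Hg; unfold admissible.
assert (E0 : width_of_angle 0 = q - p).
{ apply sqr_eq_reg; [apply width_of_angle_nonneg | lra |].
  rewrite width_of_angle_sqr, cos_0; ring. }
assert (E1 : width_of_angle PI = q + p).
{ apply sqr_eq_reg; [apply width_of_angle_nonneg | lra |].
  rewrite width_of_angle_sqr, cos_PI; ring. }
rewrite <- E0, <- E1; split; apply width_of_angle_lt_iff; lra.
Qed.

Lemma angle_of_width_spec (w : R) :
  admissible p q w ->
  0 < angle_of_width w < PI /\ width_of_angle (angle_of_width w) = w.
Proof.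
intros Hw; destruct (admissible_factors p q p_pos p_le_q w Hw) as [H0 [H1 H2]].
assert (Hpq : 0 < 2 * p * q) by nra.
assert (B : -1 < (p ^ 2 + q ^ 2 - w ^ 2) / (2 * p * q) < 1).
{ unfold admissible in Hw.
  assert (0 < (q + p - w) * (q + p + w)) by (apply Rmult_lt_0_compat; lra).
  assert (0 < (w - (q - p)) * (w + (q - p))) by (apply Rmult_lt_0_compat; lra).
  split; [apply Rlt_div_r | apply Rlt_div_l]; lra. }
split; [apply acos_bound_lt, B|].
apply sqr_eq_reg; [apply width_of_angle_nonneg | lra |].
rewrite width_of_angle_sqr; unfold angle_of_width; rewrite cos_acos by lra.
field; lra.
Qed.

Lemma bisector_fun_width (g : R) :
  0 < g < PI ->
  bisector_fun p q g = sqrt (bisector_sqr p q (width_of_angle g)).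
Proof.
intros Hg; pose proof (width_of_angle_admissible g Hg) as Hw.
destruct (admissible_factors p q p_pos p_le_q _ Hw) as [H0 [H1 H2]].
pose proof (width_of_angle_sqr g) as E.
assert (Hs : 0 < sin g) by (apply sin_gt_0; lra).
unfold bisector_fun.
set (w := width_of_angle g) in *; set (s := sin g) in *.
replace (sqrt (_ - _)) with (w / s).
2:{ symmetry; rewrite <- (sqrt_pow2 (w / s)).
  - f_equal; transitivity (w ^ 2 / s ^ 2); [|field; lra].
    rewrite E; field; lra.
  - apply Rlt_le, Rdiv_lt_0_compat; lra. }
(* Heron's formula once more: it eliminates [sin gamma] in favour of [w]. *)
assert (Es : 4 * p ^ 2 * q ^ 2 * s ^ 2 =
  ((p + w) ^ 2 - q ^ 2) * (q ^ 2 - (w - p) ^ 2)).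
{ transitivity (4 * p ^ 2 * q ^ 2 - (p ^ 2 + q ^ 2 - w ^ 2) ^ 2); [|ring].
  pose proof (sin2_cos2 g) as SC; unfold Rsqr in SC; fold s in SC.
  replace (s ^ 2) with (1 - cos g ^ 2) by lra; rewrite E; ring. }
f_equal; unfold bisector_sqr, quartic.
transitivity (p * w * ((p + w) ^ 2 - q ^ 2) / ((p + w) ^ 2 * s ^ 2)).
{ field; repeat split; lra. }
transitivity (4 * p ^ 3 * q ^ 2 * w * ((p + w) ^ 2 - q ^ 2)
  / ((p + w) ^ 2 * (4 * p ^ 2 * q ^ 2 * s ^ 2))); [field; lra|].
rewrite Es; field; repeat split; lra.
Qed.

End Angle.

(** * The case [q / 2 < p < q]: the local maximum and the number of roots *)

Section Maximum.

Variables p q : R.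
Hypothesis p_pos : 0 < p.
Hypothesis p_range : q / 2 < p < q.

Definition peak : R := sqrt ((q ^ 2 - p ^ 2) / 3).

Lemma peak_sqr : 3 * peak ^ 2 = q ^ 2 - p ^ 2.
Proof. unfold peak; rewrite pow2_sqrt; [field | nra]. Qed.

(** Once squared, both inequalities reduce to [q < 2 * p]. *)
Lemma peak_bounds : q - p < peak < p.
Proof.
pose proof peak_sqr as E.
assert (0 <= peak) by apply sqrt_pos.
split; apply sqr_lt_reg; nra.
Qed.

Lemma peak_admissible : admissible p q peak.
Proof. pose proof peak_bounds; unfold admissible; lra. Qed.

Lemma bisector_sqr_left_of_peak (x y : R) :
  q - p < x -> x < y -> y <= peak -> bisector_sqr p q x < bisector_sqr p q y.
Proof.
intros Hx Hxy Hy; pose proof peak_bounds as B; pose proof peak_sqr as E.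
apply bisector_sqr_lt_left; unfold admissible; try lra; nra.
Qed.

Lemma bisector_sqr_right_of_peak (x y : R) :
  peak <= x -> x < y -> y <= p -> bisector_sqr p q y < bisector_sqr p q x.
Proof.
intros Hx Hxy Hy; pose proof peak_bounds as B; pose proof peak_sqr as E.
apply bisector_sqr_gt_middle; unfold admissible; try lra; nra.
Qed.

Lemma bisector_sqr_le_peak (w : R) :
  q - p < w <= p -> bisector_sqr p q w <= bisector_sqr p q peak.
Proof.
intros Hw; destruct (Rtotal_order w peak) as [L|[->|L]].
- apply Rlt_le, bisector_sqr_left_of_peak; lra.
- apply Rle_refl.
- apply Rlt_le, bisector_sqr_right_of_peak; lra.
Qed.

(** On the given interval of angles the bisector length strictly increases up to the angle of [peak]
    and strictly decreases afterwards, so no other angle can be a local maximum. *)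
Lemma is_lmax_iff (m : R) :
  is_lmax p q m <-> m = sqrt (bisector_sqr p q peak).
Proof.
assert (Hle : p <= q) by lra.
pose proof peak_bounds as B.
assert (Hp : admissible p q p) by (unfold admissible; lra).
(* The right end of the interval is the angle with [w = p], so the interval corresponds to the
   widths between [q - p] and [p]. *)
assert (Epi : acos (q / (2 * p)) = angle_of_width p q p)
  by (unfold angle_of_width; f_equal; field; lra).
unfold is_lmax; rewrite Epi.
destruct (angle_of_width_spec p q p_pos Hle p Hp) as [G1 W1].
destruct (angle_of_width_spec p q p_pos Hle _ peak_admissible) as [G2 W2].
set (g1 := angle_of_width p q p) in *.
set (g2 := angle_of_width p q peak) in *.
assert (G12 : g2 < g1) by (apply (width_of_angle_lt_iff p q p_pos Hle); lra).
assert (Bf : forall g, 0 < g < PI ->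
    bisector_fun p q g = sqrt (bisector_sqr p q (width_of_angle p q g)))
  by (intros; apply bisector_fun_width; easy).
assert (Pos : forall w, admissible p q w -> 0 < bisector_sqr p q w).
{ intros w Hw; destruct (admissible_factors p q p_pos Hle w Hw) as [H0 _].
  apply Rdiv_lt_0_compat; [|apply quartic_pos; easy].
  repeat apply Rmult_lt_0_compat; lra. }
assert (Adm : forall g, 0 < g < PI -> admissible p q (width_of_angle p q g))
  by (intros; apply width_of_angle_admissible; easy).
assert (Mono : forall g g', 0 < g < PI -> 0 < g' < PI ->
  bisector_sqr p q (width_of_angle p q g) <
    bisector_sqr p q (width_of_angle p q g') ->
  bisector_fun p q g < bisector_fun p q g').
{ intros g g' Hg Hg' L; rewrite !Bf by easy; apply sqrt_lt_1_alt.
  split; [apply Rlt_le, Pos, Adm; easy | easy]. }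
split.
- intros [g [Hg [[eps Hloc] <-]]].
  assert (Hloc' : forall y, Rabs (y - g) < eps ->
    bisector_fun p q y <= bisector_fun p q g) by (intros y; apply Hloc).
  clear Hloc; destruct eps as [e He]; simpl in Hloc'.
  assert (A := Adm g); unfold admissible in A.
  destruct (Rtotal_order g g2) as [L|[->|L]].
  (* A small move from [g] towards [g2] stays within the neighbourhood and increases the value; the
     case [g2 < g] is symmetric. *)
  + exfalso; set (y := Rmin (g + e / 2) g2).
    assert (Hy : g < y /\ y <= g2 /\ y <= g + e / 2)
      by (unfold y, Rmin; destruct Rle_dec; lra).
    apply (Rlt_not_le (bisector_fun p q y) (bisector_fun p q g)).
    * apply Mono; try lra; apply bisector_sqr_left_of_peak; try lra.
      -- apply (width_of_angle_lt_iff p q p_pos Hle); lra.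
      -- rewrite <- W2; apply (width_of_angle_le p q p_pos Hle); lra.
    * apply Hloc'; rewrite Rabs_pos_eq; lra.
  + now rewrite Bf, W2 by lra.
  + exfalso; set (y := Rmax (g - e / 2) g2).
    assert (Hy : y < g /\ g2 <= y /\ g - e / 2 <= y)
      by (unfold y, Rmax; destruct Rle_dec; lra).
    apply (Rlt_not_le (bisector_fun p q y) (bisector_fun p q g)).
    * apply Mono; try lra; apply bisector_sqr_right_of_peak.
      -- rewrite <- W2; apply (width_of_angle_le p q p_pos Hle); lra.
      -- apply (width_of_angle_lt_iff p q p_pos Hle); lra.
      -- eapply Rle_trans; [|right; exact W1].
         apply (width_of_angle_le p q p_pos Hle); lra.
    * apply Hloc'; rewrite Rabs_left; lra.
- intros ->; exists g2; split; [lra|]; split; [|now rewrite Bf, W2 by lra].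
  (* The whole interval serves as neighbourhood, as [peak] is maximal on all of it. *)
  unfold local_maximum; apply (filter_imp (fun y => 0 < y /\ y < g1)).
  + intros y Hy; rewrite !Bf, W2 by lra; apply sqrt_le_1_alt.
    apply bisector_sqr_le_peak; split.
    * apply (Adm y); lra.
    * eapply Rle_trans; [|right; exact W1].
         apply (width_of_angle_le p q p_pos Hle); lra.
  + apply filter_and; [apply (open_gt 0) | apply (open_lt g1)]; lra.
Qed.

(** The signs of [root_poly] at [q - p], [peak], [p], [q + p] are +, -, +, -, and each of the three
    pieces between them is monotone for [bisector_sqr]. *)
Lemma three_roots (K : R) :
  p ^ 2 < K < bisector_sqr p q peak ->
  exists x y z : R, x < y < z /\
    forall w : R, In w (x :: y :: z :: nil) <->
      admissible p q w /\ bisector_sqr p q w = K.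
Proof.
intros HK; assert (Hle : p <= q) by lra.
pose proof peak_bounds as B; pose proof peak_admissible as Hr.
assert (Hp : admissible p q p) by (unfold admissible; lra).
assert (Sr : root_poly p q K peak < 0).
{ rewrite root_poly_eq by easy; apply Rmult_pos_neg; [|lra].
  apply quartic_pos; easy. }
assert (Sp : 0 < root_poly p q K p).
{ rewrite root_poly_eq, bisector_sqr_height by easy.
  apply Rmult_lt_0_compat; [apply quartic_pos; easy | lra]. }
destruct (bisector_sqr_root p q p_pos Hle K (q - p) peak)
  as [x [Hx [Ax Ex]]]; try lra.
{ apply Rmult_pos_neg; [apply root_poly_left; lra | easy]. }
destruct (bisector_sqr_root p q p_pos Hle K peak p) as [y [Hy [Ay Ey]]];
  try lra.
{ rewrite Rmult_comm; apply Rmult_pos_neg; easy. }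
destruct (bisector_sqr_root_right p q p_pos Hle K) as [z [Hz [Az Ez]]];
  try lra.
exists x, y, z; split; [lra|].
intros w; simpl; split; [intros [<-|[<-|[<-|[]]]]; easy|].
intros [[Aw Aw'] Ew].
destruct (Rlt_le_dec p w) as [L|L].
- right; right; left; apply (bisector_sqr_inj_right p q); unfold admissible in *;
    try lra.
- destruct (Rle_lt_dec w peak) as [L'|L'].
  + left; destruct (Rtotal_order x w) as [C|[C|C]]; [|easy|];
      apply bisector_sqr_left_of_peak in C; unfold admissible in *; lra.
  + right; left; destruct (Rtotal_order y w) as [C|[C|C]]; [|easy|];
      apply bisector_sqr_right_of_peak in C; lra.
Qed.

(** At the peak value the two roots below [p] merge into one; the root beyond [p] persists. *)
Lemma two_roots_peak :
  exists z : R, peak < z /\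
    forall w : R, In w (peak :: z :: nil) <->
      admissible p q w /\ bisector_sqr p q w = bisector_sqr p q peak.
Proof.
assert (Hle : p <= q) by lra.
pose proof peak_bounds as B; pose proof peak_admissible as Hr.
destruct (bisector_sqr_root_right p q p_pos Hle (bisector_sqr p q peak))
  as [z [Hz [Az Ez]]]; [lra | apply bisector_sqr_gt_height; lra || easy |].
exists z; split; [lra|].
intros w; simpl; split; [intros [<-|[<-|[]]]; easy|].
intros [[Aw Aw'] Ew].
destruct (Rlt_le_dec p w) as [L|L].
- right; left; apply (bisector_sqr_inj_right p q); unfold admissible in *;
    try lra.
- left; destruct (Rtotal_order peak w) as [C|[C|C]]; [|easy|].
  + apply bisector_sqr_right_of_peak in C; lra.
  + apply bisector_sqr_left_of_peak in C; lra.
Qed.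

Lemma one_root_above_peak (K : R) :
  bisector_sqr p q peak < K ->
  exists z : R, forall w : R, In w (z :: nil) <->
    admissible p q w /\ bisector_sqr p q w = K.
Proof.
intros HK; assert (Hle : p <= q) by lra.
pose proof peak_bounds as B; pose proof peak_admissible as Hr.
pose proof (bisector_sqr_gt_height p q p_pos Hle peak Hr).
destruct (bisector_sqr_root_right p q p_pos Hle K) as [z [Hz [Az Ez]]];
  try lra.
exists z; intros w; simpl; split; [intros [<-|[]]; easy|].
intros [[Aw Aw'] Ew]; left.
destruct (Rlt_le_dec p w) as [L|L].
- apply (bisector_sqr_inj_right p q); unfold admissible in *; try lra.
- pose proof (bisector_sqr_le_peak w); lra.
Qed.

Lemma one_root_height (w : R) :
  In w (p :: nil) <-> admissible p q w /\ bisector_sqr p q w = p ^ 2.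
Proof.
assert (Hle : p <= q) by lra.
assert (Hp : admissible p q p) by (unfold admissible; lra).
simpl; split.
- intros [<-|[]]; split; [easy | apply bisector_sqr_height; easy].
- intros [Aw Ew]; left; destruct (Req_dec w p) as [->|N]; [easy|].
  pose proof (bisector_sqr_gt_height p q p_pos Hle w Aw N); lra.
Qed.

End Maximum.

(** * The remaining cases: equal heights, and [p <= q / 2] *)

Lemma isosceles_two_roots (p K : R) :
  0 < p -> p ^ 2 < K < 2 * p ^ 2 ->
  exists x y : R, x < y /\
    forall w : R, In w (x :: y :: nil) <->
      admissible p p w /\ bisector_sqr p p w = K.
Proof.
intros Hp HK; assert (Hle : p <= p) by lra.
(* [root_poly p p K] vanishes at 0, so its quotient by [w] is used instead. *)
set (f := fun w => K * ((p + w) ^ 2 * (2 * p - w)) - 4 * p ^ 5).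
assert (Ef : forall w, root_poly p p K w = w * f w)
  by (intros w; unfold root_poly, quartic, f; ring).
assert (P3 : 0 < p ^ 3) by (apply pow_lt; lra).
(* The value [2 * p ^ 2] is the limit of the squared bisector length as [w] tends to 0; this is the
   source of the factor [sqrt 2]. *)
assert (F0 : f 0 < 0).
{ unfold f; replace (_ - _) with (2 * p ^ 3 * (K - 2 * p ^ 2)) by ring.
  apply Rmult_pos_neg; lra. }
assert (F1 : 0 < f p).
{ unfold f; replace (_ - _) with (4 * p ^ 3 * (K - p ^ 2)) by ring.
  apply Rmult_lt_0_compat; lra. }
assert (Hc : continuity f) by (unfold f; reg).
destruct (IVT f 0 p Hc Hp F0 F1) as [x [Hx Zx]].
assert (x <> 0) by (intros ->; lra).
assert (x <> p) by (intros ->; lra).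
assert (Ax : admissible p p x) by (unfold admissible; lra).
assert (Ex : bisector_sqr p p x = K).
{ apply bisector_sqr_eq_iff; try easy.
  apply Rminus_diag_uniq; fold (root_poly p p K x); rewrite Ef, Zx; ring. }
destruct (bisector_sqr_root_right p p Hp Hle K) as [y [Hy [Ay Ey]]]; try lra.
exists x, y; split; [lra|].
intros w; simpl; split; [intros [<-|[<-|[]]]; easy|].
intros [[Aw Aw'] Ew].
destruct (Rlt_le_dec p w) as [L|L].
- right; left; apply (bisector_sqr_inj_right p p); unfold admissible in *;
    try lra.
- left; destruct (Rtotal_order x w) as [C|[C|C]]; [|easy|];
    apply (bisector_sqr_gt_middle p p) in C; unfold admissible in *; nra.
Qed.

Lemma isosceles_one_root (p K : R) :
  0 < p -> 2 * p ^ 2 <= K ->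
  exists z : R, forall w : R, In w (z :: nil) <->
    admissible p p w /\ bisector_sqr p p w = K.
Proof.
intros Hp HK; assert (Hle : p <= p) by lra.
assert (P2 : 0 < p ^ 2) by (apply pow_lt; lra).
destruct (bisector_sqr_root_right p p Hp Hle K) as [z [Hz [Az Ez]]]; try lra.
exists z; intros w; simpl; split; [intros [<-|[]]; easy|].
intros [Aw Ew]; left.
destruct (Rlt_le_dec p w) as [L|L].
- apply (bisector_sqr_inj_right p p); unfold admissible in *; try lra.
(* For [w <= p] the squared bisector length stays strictly below its limit [2 * p ^ 2] at 0, hence
   below [K]. *)
- exfalso; apply bisector_sqr_eq_iff in Ew; try easy.
  pose proof (quartic_pos p p Hp Hle w Aw) as G; unfold admissible in Aw.
  assert (HG : 4 * p ^ 5 * w < 2 * p ^ 2 * quartic p p w).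
  { apply Rminus_lt_0; unfold quartic.
    replace (_ - _) with (2 * p ^ 2 * (w ^ 2 * (3 * p ^ 2 - w ^ 2))) by ring.
    assert (w ^ 2 <= p ^ 2) by nra.
    repeat apply Rmult_lt_0_compat; try lra; nra. }
  assert (2 * p ^ 2 * quartic p p w <= K * quartic p p w)
    by (apply Rmult_le_compat_r; lra).
  lra.
Qed.

(** Now [q - p >= p] and [3 (q - p)^2 >= q^2 - p^2], so the increasing regime covers the whole
    admissible interval. *)
Lemma one_root_small_height (p q K : R) :
  0 < p -> p <= q / 2 -> p ^ 2 < K ->
  exists z : R, forall w : R, In w (z :: nil) <->
    admissible p q w /\ bisector_sqr p q w = K.
Proof.
intros Hp Hpq HK; assert (Hle : p <= q) by lra.
destruct (bisector_sqr_root p q Hp Hle K (q - p) (q + p))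
  as [z [_ [Az Ez]]]; try lra.
{ apply Rmult_pos_neg; [apply root_poly_left; lra | apply root_poly_right; lra]. }
exists z; intros w; simpl; split; [intros [<-|[]]; easy|].
intros [Aw Ew]; left.
assert (3 * (q - p) ^ 2 >= q ^ 2 - p ^ 2) by nra.
destruct (Rtotal_order z w) as [C|[C|C]]; [|easy|];
  apply (bisector_sqr_lt_right p q) in C; unfold admissible in *; nra.
Qed.

(** * Assembly: each case becomes a root count with [K = la ^ 2] *)

Theorem mainTheorem15 (ha hb : R) (ha_pos : 0 < ha) (ha_le_hb : ha <= hb) :
  (hb / 2 < ha < hb -> exists! m : R, is_lmax ha hb m) /\
  (forall la : R, 0 < la ->
    (hb / 2 < ha < hb /\ (exists m : R, is_lmax ha hb m /\ ha < la < m) ->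
       number_of_triangles (has_data ha hb la) 3) /\
    ((ha = hb /\ hb < la < sqrt 2 * hb) \/
     (hb / 2 < ha < hb /\ is_lmax ha hb la) ->
       number_of_triangles (has_data ha hb la) 2) /\
    ((ha = hb /\ sqrt 2 * hb <= la) \/
     (hb / 2 < ha < hb /\
        ((exists m : R, is_lmax ha hb m /\ m < la) \/ la = ha)) \/
     (ha <= hb / 2 /\ ha < la) ->
       number_of_triangles (has_data ha hb la) 1)).
Proof.
split.
{ intros H; exists (sqrt (bisector_sqr ha hb (peak ha hb))); split.
  - apply is_lmax_iff; easy.
  - intros m Hm; apply is_lmax_iff in Hm; easy. }
intros la Hla.
assert (Count := number_of_triangles_roots ha hb ha_pos ha_le_hb la).
assert (One : (exists z, forall w, In w (z :: nil) <->
    admissible ha hb w /\ bisector_sqr ha hb w = la ^ 2) ->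
  number_of_triangles (has_data ha hb la) 1).
{ intros [z Hz]; apply (Count (z :: nil)); try easy.
  repeat constructor; easy. }
assert (Two : (exists x y, x < y /\ forall w, In w (x :: y :: nil) <->
    admissible ha hb w /\ bisector_sqr ha hb w = la ^ 2) ->
  number_of_triangles (has_data ha hb la) 2).
{ intros [x [y [Hxy Hw]]]; apply (Count (x :: y :: nil)); try easy.
  repeat constructor; simpl; lra. }
(* Positivity allows the square root in [is_lmax_iff] to be undone by squaring. *)
assert (Peak : hb / 2 < ha < hb ->
  0 < bisector_sqr ha hb (peak ha hb)).
{ intros H; apply Rlt_trans with (ha ^ 2); [apply pow_lt; easy|].
  pose proof (peak_bounds ha hb ha_pos H).
  apply bisector_sqr_gt_height; try lra; apply peak_admissible; easy. }
assert (S2 : sqrt 2 ^ 2 = 2) by (apply pow2_sqrt; lra).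
assert (P2 : 0 < sqrt 2) by (apply sqrt_lt_R0; lra).
split; [|split].
- intros [H [m [Hm Hl]]]; apply is_lmax_iff in Hm; try easy.
  assert (Em : m ^ 2 = bisector_sqr ha hb (peak ha hb))
    by (subst m; apply pow2_sqrt, Rlt_le, Peak, H).
  destruct (three_roots ha hb ha_pos H (la ^ 2)) as [x [y [z [Hxyz Hw]]]].
  + rewrite <- Em; nra.
  + apply (Count (x :: y :: z :: nil)); try easy.
    repeat constructor; simpl; lra.
- intros [[<- H1]|[H Hm]]; apply Two.
  + apply isosceles_two_roots; [easy|].
    replace (2 * ha ^ 2) with ((sqrt 2 * ha) ^ 2)
      by (rewrite Rpow_mult_distr, S2; ring).
    nra.
  + apply is_lmax_iff in Hm; try easy.
    replace (la ^ 2) with (bisector_sqr ha hb (peak ha hb))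
      by (subst la; symmetry; apply pow2_sqrt, Rlt_le, Peak, H).
    exists (peak ha hb); apply two_roots_peak; easy.
- intros [[<- H1]|[[H [[m [Hm H1]]| ->]]|[H H1]]]; apply One.
  + apply isosceles_one_root; [easy|].
    replace (2 * ha ^ 2) with ((sqrt 2 * ha) ^ 2)
      by (rewrite Rpow_mult_distr, S2; ring).
    apply pow_incr; split; [apply Rmult_le_pos|]; lra.
  + apply is_lmax_iff in Hm; try easy.
    apply one_root_above_peak; try easy.
    assert (Em : m ^ 2 = bisector_sqr ha hb (peak ha hb))
      by (subst m; apply pow2_sqrt, Rlt_le, Peak, H).
    assert (0 <= m) by (subst m; apply sqrt_pos).
    rewrite <- Em; nra.
  + exists ha; apply one_root_height; easy.
  + apply one_root_small_height; try easy; nra.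
Qed.
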